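(* Let $\mathbf G\in\mathbb R^{d\times k}$ have orthonormal columns, $\mathbf G^\top\mathbf G=\mathbf I_k$ (with $k=0$ allowed, meaning that there is no constraint from $\mathbf G$ and $\mathbf G\mathbf G^\top=\mathbf 0$). Let $\mathcal M_t=\{\mathbf U\in\mathbb R^{d\times r}\mid \mathbf U^\top\mathbf U=\mathbf I_r,\ \mathbf G^\top\mathbf U=\mathbf 0\}$, and let $\widetilde{\mathbf U}\in\mathbb R^{d\times r}$ be an arbitrary matrix (ambient iterate). Consider the two-step retraction $$\mathbf Y=(\mathbf I_d-\mathbf G\mathbf G^\top)\widetilde{\mathbf U},\qquad \mathbf U^{+}=\mathbf Y(\mathbf Y^\top\mathbf Y)^{-\frac12}.$$ Then $\mathbf U^{+}\in\mathcal M_t$, and $\mathbf U^{+}$ is the unique solution to $$\min_{\mathbf U\in\mathcal M_t}\ \|\mathbf U-\widetilde{\mathbf U}\|_F^2,$$ i.e., the closest feasible point (point of $\mathcal M_t$) to $\widetilde{\mathbf U}$ in the Frobenius norm.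
   Context: All matrices are real; $d,r,k$ are the matrix dimensions, and $\mathbf I_d$, $\mathbf I_r$, $\mathbf I_k$ are identity matrices. $\|\cdot\|_F$ is the Frobenius norm. $(\mathbf Y^\top\mathbf Y)^{-\frac12}$ denotes the inverse of the symmetric positive definite square root of the $r\times r$ matrix $\mathbf Y^\top\mathbf Y$. The subscript $t$ is only a label (a task index) and plays no mathematical role.
   Formalization: The matrix Ũ is not arbitrary: Y = (I − GG^T)Ũ is assumed to have full column rank r, which is exactly when Y^T Y has a symmetric positive definite square root, so that U⁺ is defined (it is not, for example, for Ũ = 0 with r ≥ 1). *)

(* Defs.v *)
From HB Require Import structures.
From mathcomp Require Import all_boot all_order all_algebra.
From mathcomp Require Import boolp classical_sets reals.

Set Implicit Arguments.
Unset Strict Implicit.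
Unset Printing Implicit Defensive.

Import Order.TTheory GRing.Theory Num.Theory.

Local Open Scope ring_scope.
Local Open Scope classical_set_scope.

(* The norm of matrices in MathComp-Analysis is the sup norm. *)
Definition frobenius_norm (R : realType) (m n : nat) (A : 'M[R]_(m, n)) : R :=
  Num.sqrt (\sum_(i < m) \sum_(j < n) A i j ^+ 2).

Definition sym_posdef (R : realType) (n : nat) (A : 'M[R]_n) : Prop :=
  A^T = A /\
  forall x : 'cV[R]_n, x != 0 -> 0 < (x^T *m A *m x) ord0 ord0.

(* A symmetric positive definite matrix has exactly one symmetric positive
   definite square root, so the choice made by xget is immaterial; the value is
   the junk matrix 0 when A is not symmetric positive definite. *)
Definition spd_sqrtmx (R : realType) (n : nat) (A : 'M[R]_n) : 'M[R]_n :=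
  xget 0 [set S : 'M[R]_n | sym_posdef S /\ S *m S = A].

Definition inv_sqrtmx (R : realType) (n : nat) (A : 'M[R]_n) : 'M[R]_n :=
  invmx (spd_sqrtmx A).

Definition feasible_set (R : realType) (d r k : nat) (G : 'M[R]_(d, k)) :
    set 'M[R]_(d, r) :=
  [set U | U^T *m U = 1%:M /\ G^T *m U = 0].

Definition minimizers (R : realType) (T : Type) (M : set T) (f : T -> R) :
    set T :=
  [set U | M U /\ forall V, M V -> f U <= f V].

(* Main.v *)
(* With S the positive definite square root of Y^T Y we have Y = U+ S, and
   tr(U^T Ut) = tr(U^T Y) for every feasible U since U^T G = 0. As ||U||_F is
   constant on the feasible set, the excess of the objective at U over its value
   at U+ is 2 (tr S - tr(U^T U+ S)) = tr((U - U+) S (U - U+)^T), which is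
   positive unless U = U+. *)
Require Import Defs.
From HB Require Import structures.
From mathcomp Require Import all_boot all_order all_algebra.
From mathcomp Require Import boolp classical_sets reals.
From mathcomp Require Import polyrcf complex.

Set Implicit Arguments.
Unset Strict Implicit.
Unset Printing Implicit Defensive.

Import Order.TTheory GRing.Theory Num.Theory.

Local Open Scope ring_scope.
Local Open Scope classical_set_scope.

(** Newton interpolation; it later yields a matrix root that is a polynomial in the matrix. *)
Lemma ex_interpolation_poly (F : fieldType) (s : seq F) (f : F -> F) :
  exists p : {poly F}, forall x, x \in s -> p.[x] = f x.
Proof.
elim: s => [|a s [p hp]]; first by exists 0.
have [as_|nas] := boolP (a \in s).
  by exists p => x; rewrite inE => /predU1P[->|]; apply: hp.
pose w : {poly F} := \prod_(b <- s) ('X - b%:P).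
have w_s x : (w.[x] == 0) = (x \in s) by rewrite -[LHS]/(root w x) root_prod_XsubC.
(* The correction term vanishes on [s], and [w.[a]] is nonzero because [a] is not in [s]. *)
exists (p + ((f a - p.[a]) / w.[a]) *: w) => x.
rewrite inE !hornerE => /predU1P[->|xs].
  by rewrite divfK ?w_s // addrC subrK.
have /eqP -> : w.[x] == 0 by rewrite w_s.
by rewrite mulr0 addr0 hp.
Qed.

Section PositiveDefinite.
Variable R : realType.

Lemma mxtrace_gram (m n : nat) (A : 'M[R]_(m, n)) :
  \tr (A^T *m A) = \sum_(i < m) \sum_(j < n) A i j ^+ 2.
Proof.
rewrite exchange_big /mxtrace /=; apply: eq_bigr => j _; rewrite mxE.
by apply: eq_bigr => i _; rewrite mxE expr2.
Qed.

Lemma mxtrace_gram_ge0 (m n : nat) (A : 'M[R]_(m, n)) : 0 <= \tr (A^T *m A).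
Proof.
rewrite mxtrace_gram sumr_ge0 // => i _; rewrite sumr_ge0 // => j _.
exact: sqr_ge0.
Qed.

Lemma sqr_frobenius_norm (m n : nat) (A : 'M[R]_(m, n)) :
  frobenius_norm A ^+ 2 = \tr (A^T *m A).
Proof. by rewrite /frobenius_norm -mxtrace_gram sqr_sqrtr // mxtrace_gram_ge0. Qed.

Lemma mxtrace_gram_gt0 (m n : nat) (A : 'M[R]_(m, n)) :
  A != 0 -> 0 < \tr (A^T *m A).
Proof.
move=> A0; rewrite lt_def mxtrace_gram_ge0 andbT.
apply: contra A0 => /eqP; rewrite mxtrace_gram => A0.
have sq_ge0 i : 0 <= \sum_(j < n) A i j ^+ 2.
  by rewrite sumr_ge0 // => j _; rewrite sqr_ge0.
apply/eqP/matrixP => i j; rewrite mxE.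
have Ai : \sum_(j < n) A i j ^+ 2 = 0.
  by have /eqP := A0; rewrite psumr_eq0 // => /allP /(_ i (mem_index_enum _)) /eqP.
have /eqP := Ai; rewrite psumr_eq0 => [|k _]; last exact: sqr_ge0.
by move=> /allP /(_ j (mem_index_enum _)); rewrite sqrf_eq0 => /eqP.
Qed.

(** The quadratic form at [x] is the squared norm of [A *m x], and full column rank makes [A]
    injective. *)
Lemma gram_posdef (m n : nat) (A : 'M[R]_(m, n)) :
  \rank A = n -> sym_posdef (A^T *m A).
Proof.
move=> rA; split=> [|x x0]; first by rewrite trmx_mul trmxK.
have -> : x^T *m (A^T *m A) *m x = (A *m x)^T *m (A *m x).
  by rewrite trmx_mul !mulmxA.
rewrite -trace_mx11 mxtrace_gram_gt0 //; apply: contra x0 => /eqP Ax.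
have free : row_free A^T by rewrite /row_free mxrank_tr rA.
apply/eqP/trmx_inj/(row_free_inj free).
by rewrite -trmx_mul Ax !trmx0 mul0mx.
Qed.

Lemma posdef_unitmx (n : nat) (S : 'M[R]_n) : sym_posdef S -> S \in unitmx.
Proof.
case=> _ pS; rewrite -row_free_unit -kermx_eq0; apply/rowV0P => v /sub_kermxP vS.
apply/eqP/negPn/negP; rewrite -trmx_eq0 => /pS.
by rewrite trmxK vS mul0mx mxE ltxx.
Qed.

(** The trace adds up the quadratic form of [S] at the rows of [W], one of which is nonzero. *)
Lemma posdef_mxtrace_gt0 (m n : nat) (S : 'M[R]_n) (W : 'M[R]_(m, n)) :
  sym_posdef S -> W != 0 -> 0 < \tr (W *m S *m W^T).
Proof.
case=> _ pS W0.
have trE : \tr (W *m S *m W^T) =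
    \sum_(i < m) ((row i W)^T^T *m S *m (row i W)^T) ord0 ord0.
  apply: eq_bigr => i _; rewrite trmxK -row_mul !mxE.
  by apply: eq_bigr => j _; rewrite !mxE.
have row_ge0 i : 0 <= ((row i W)^T^T *m S *m (row i W)^T) ord0 ord0.
  have [->|Wi] := eqVneq (row i W) 0; first by rewrite !trmx0 mulmx0 mxE.
  by rewrite ltW // pS // trmx_eq0.
have [i Wi] : exists i, row i W != 0.
  apply/existsP; apply: contraR W0 => /existsPn W_0; apply/eqP/row_matrixP => i.
  by rewrite row0; apply/eqP/negPn/W_0.
rewrite trE (bigD1 i) //= ltr_pwDl ?sumr_ge0 //.
by rewrite pS // trmx_eq0.
Qed.

Lemma posdef_eigenvalue_gt0 (n : nat) (A : 'M[R]_n) (a : R) :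
  sym_posdef A -> eigenvalue A a -> 0 < a.
Proof.
case=> _ pA /eigenvalueP [v vA v0].
have vv : 0 < (v *m v^T) ord0 ord0.
  by rewrite -trace_mx11 -{1}[v]trmxK mxtrace_gram_gt0 // trmx_eq0.
have := pA v^T; rewrite trmx_eq0 trmxK vA -scalemxAl mxE => /(_ v0).
by rewrite pmulr_lgt0.
Qed.

Lemma trmx_horner_mx (n : nat) (A : 'M[R]_n.+1) (p : {poly R}) :
  (horner_mx A p)^T = horner_mx A^T p.
Proof.
elim/poly_ind: p => [|p c IH]; first by rewrite !rmorph0 trmx0.
rewrite !rmorphD !rmorphM /= !horner_mx_X !horner_mx_C linearD /= tr_scalar_mx.
rewrite trmx_mul IH; congr (_ + _).
(* Transposition reversed the product, but [A^T] commutes with polynomials in itself. *)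
exact: comm_mx_horner.
Qed.

(* The matrix is diagonalized over [R[i]]; a polynomial with real coefficients
   annihilating its (real) spectrum annihilates the matrix itself. *)
Lemma sym_horner_mx_eq0 (n : nat) (A : 'M[R]_n.+1) (p : {poly R}) :
  A^T = A -> (forall a, eigenvalue A a -> p.[a] = 0) -> horner_mx A p = 0.
Proof.
move=> symA hp.
pose f := real_complex R; pose B := map_mx f A.
have hermB : B \is hermsymmx.
  apply: realsym_hermsym.
    by apply/is_hermitianmxP; rewrite scale1r map_mx_id // /B map_trmx symA.
  apply/mxOverP => i j; rewrite mxE; apply/complex_realP; by exists (A i j).
have defB := orthomx_spectralP (hermitian_normalmx hermB).
have realD := hermitian_spectral_diag_real hermB.
have uP := spectral_unit B.
move: (spectralmx B) (spectral_diag B) defB realD uP => P D defB realD uP.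
apply: (map_mx_inj (f := f)); rewrite map_mx0 map_horner_mx -/B defB.
rewrite horner_mx_uconjC // horner_mx_diag.
suff -> : map_mx (horner (map_poly f p)) D = 0.
  by rewrite linear0 mulmx0 mul0mx.
apply/matrixP => i j; rewrite !mxE ord1.
have /mxOverP/(_ 0 j)/complex_realP [a Da] := realD.
rewrite Da -[X in horner _ X]/(f a) horner_map hp ?rmorph0 //.
(* Being an eigenvalue descends from [B] to [A] through the roots of the characteristic
   polynomial. *)
rewrite eigenvalue_root_char -(fmorph_root f) map_char_poly -eigenvalue_root_char.
(* Since [P *m B = diag_mx D *m P], the rows of [P] are left eigenvectors; they are nonzero as [P]
   is invertible. *)
apply/eigenvalueP; exists (row j P).
  rewrite -/B defB -!row_mul mulmxA mulmxA mulmxV // mul1mx row_mul row_diag_mx.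
  by rewrite -scalemxAl -rowE Da.
apply/eqP => Pj; have := mulmxV uP => /(congr1 (row j)).
rewrite row_mul Pj mul0mx => /matrixP/(_ 0 j); rewrite !mxE eqxx.
by move/eqP; rewrite eq_sym oner_eq0.
Qed.

(* Interpolating fourth roots of the spectrum makes the square root itself the
   square of an invertible symmetric matrix, hence positive definite. *)
Lemma posdef_sqrtmx_exists (n : nat) (A : 'M[R]_n) :
  sym_posdef A -> exists S : 'M[R]_n, sym_posdef S /\ S *m S = A.
Proof.
(* [horner_mx] requires a positive size, so the empty matrix is treated apart. *)
case: n A => [|n] A pA.
  exists 0; split; last by apply/matrixP => -[].
  by split=> [|x]; [rewrite trmx0 | rewrite flatmx0 eqxx].
have [symA _] := pA.
have char0 : char_poly A != 0 by rewrite monic_neq0 // char_poly_monic.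
have [q hq] : exists q : {poly R}, forall a, eigenvalue A a -> q.[a] ^+ 4 = a.
  have hs a : eigenvalue A a -> a \in rootsR (char_poly A).
    by rewrite -roots_on_rootsR // eigenvalue_root_char itv_boundlr.
  have [q hq] := ex_interpolation_poly (rootsR (char_poly A)) (fun a => Num.sqrt (Num.sqrt a)).
  exists q => a ea; rewrite hq ?hs // (exprM _ 2 2) !sqr_sqrtr ?sqrtr_ge0 //.
  exact/ltW/(posdef_eigenvalue_gt0 pA).
pose Q := horner_mx A q.
have symQ : Q^T = Q by rewrite /Q trmx_horner_mx symA.
have Q4 : (Q *m Q) *m (Q *m Q) = A.
  apply/eqP; rewrite -subr_eq0; apply/eqP.
  have <- : horner_mx A (q ^+ 4 - 'X) = (Q *m Q) *m (Q *m Q) - A.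
    by rewrite rmorphB rmorphXn /= horner_mx_X (exprM _ 2 2) !expr2.
  apply: sym_horner_mx_eq0 => // a ea.
  by rewrite !hornerE hq // subrr.
exists (Q *m Q); split=> //.
(* By symmetry [Q *m Q] is the Gram matrix of [Q], which is invertible because its fourth power [A]
   is. *)
rewrite -{1}symQ; apply: gram_posdef; apply/eqP.
rewrite -[_ == _]/(row_free Q) row_free_unit.
by have := posdef_unitmx pA; rewrite -Q4 !unitmx_mul => /andP[/andP[]].
Qed.

Lemma spd_sqrtmxP (n : nat) (A : 'M[R]_n) :
  sym_posdef A ->
  sym_posdef (spd_sqrtmx A) /\ spd_sqrtmx A *m spd_sqrtmx A = A.
Proof.
move=> /posdef_sqrtmx_exists exS.
exact: (@xgetPex _ 0 [set S | sym_posdef S /\ S *m S = A] exS).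
Qed.

Lemma feasible_mul_proj (d r k : nat) (G : 'M[R]_(d, k)) (U V : 'M[R]_(d, r)) :
  feasible_set G U -> U^T *m ((1%:M - G *m G^T) *m V) = U^T *m V.
Proof.
case=> _ GU; have UG : U^T *m G = 0 by rewrite -[G]trmxK -trmx_mul GU trmx0.
by rewrite mulmxA mulmxBr mulmx1 mulmxA UG mul0mx subr0.
Qed.

Lemma feasible_sqr_dist (d r k : nat) (G : 'M[R]_(d, k)) (U V : 'M[R]_(d, r)) :
  feasible_set G U ->
  frobenius_norm (U - V) ^+ 2 = r%:R - \tr (U^T *m V) *+ 2 + \tr (V^T *m V).
Proof.
case=> UU _; rewrite sqr_frobenius_norm [(U - V)^T]linearB /= mulmxBl !mulmxBr UU.
rewrite !linearB /= mxtrace1 -[in \tr (V^T *m U)]mxtrace_tr trmx_mul trmxK.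
by rewrite opprB mulr2n opprD !addrA [in LHS]addrAC.
Qed.

(** After cyclic permutation each square term contributes [\tr S], and the two cross terms are
    transposes of each other up to cyclicity. *)
Lemma mxtrace_stiefel_gap (d r : nat) (U V : 'M[R]_(d, r)) (S : 'M[R]_r) :
  U^T *m U = 1%:M -> V^T *m V = 1%:M -> S^T = S ->
  \tr ((U - V) *m S *m (U - V)^T) = (\tr S - \tr (U^T *m (V *m S))) *+ 2.
Proof.
move=> UU VV symS.
have VU : \tr (S *m (V^T *m U)) = \tr (U^T *m (V *m S)).
  by rewrite -mxtrace_tr !trmx_mul trmxK symS mulmxA.
rewrite mxtrace_mulC [in LHS]mulmxA mxtrace_mulC [(U - V)^T]linearB /=.
rewrite mulmxBl !mulmxBr UU VV !linearB /= !mulmx1 VU.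
rewrite [\tr (S *m (U^T *m V))]mxtrace_mulC -mulmxA.
by rewrite mulr2n opprB.
Qed.

End PositiveDefinite.

Theorem proposition3p2 (R : realType) (d r k : nat)
    (G : 'M[R]_(d, k)) (hG : G^T *m G = 1%:M) (Ut : 'M[R]_(d, r)) :
  let Y : 'M[R]_(d, r) := (1%:M - G *m G^T) *m Ut in
  \rank Y = r ->
  let Uplus : 'M[R]_(d, r) := Y *m inv_sqrtmx (Y^T *m Y) in
  feasible_set G Uplus /\
  minimizers (feasible_set G) (fun U => frobenius_norm (U - Ut) ^+ 2) =
    [set Uplus].
Proof.
move=> Y rankY Uplus.
(* Full column rank ensures that [spd_sqrtmx] returns a genuine root and not its default value 0. *)
have [pS SS] := spd_sqrtmxP (gram_posdef rankY).
set S := spd_sqrtmx _ in pS SS.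
have uS := posdef_unitmx pS; have [symS _] := pS.
have YE : Y = Uplus *m S by rewrite /Uplus mulmxKV.
have feasU : feasible_set G Uplus.
  split; last first.
    rewrite /Uplus /Y !mulmxA mulmxBr mulmx1 mulmxA hG mul1mx subrr.
    by rewrite !mul0mx.
  (* The Gram matrix of [Uplus] is the product of [invmx S], [S *m S] and [invmx S]. *)
  rewrite /Uplus trmx_mul mulmxA -[_ *m Y^T *m Y]mulmxA -SS /inv_sqrtmx SS -/S.
  by rewrite trmx_inv symS -SS mulKmx // mulmxV.
have gap U : feasible_set G U ->
    frobenius_norm (U - Ut) ^+ 2 - frobenius_norm (Uplus - Ut) ^+ 2 =
    \tr ((U - Uplus) *m S *m (U - Uplus)^T).
  move=> feas; have [UU _] := feas; have [UpUp _] := feasU.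
  rewrite (feasible_sqr_dist _ feas) (feasible_sqr_dist _ feasU).
  rewrite mxtrace_stiefel_gap // -YE.
  have -> : \tr S = \tr (Uplus^T *m Y) by rewrite YE mulmxA UpUp mul1mx.
  rewrite (feasible_mul_proj _ feas) (feasible_mul_proj _ feasU).
  by rewrite [- (_ + \tr (Ut^T *m Ut))]opprD addrACA subrr addr0 opprB addrC addrA subrK mulrnBl.
split=> //; apply/seteqP; split=> [U [feas minU]|U ->]; last first.
  split=> // V feas; rewrite -subr_ge0 gap //.
  have [->|VU] := eqVneq (V - Uplus) 0; first by rewrite !mul0mx mxtrace0.
  exact/ltW/posdef_mxtrace_gt0.
(* A minimizer other than [Uplus] would have a strictly positive gap, against its minimality. *)
apply/eqP; rewrite -subr_eq0; apply: contraT => UU.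
have := posdef_mxtrace_gt0 pS UU; rewrite -gap // subr_gt0.
by rewrite ltNge minU.
Qed.
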